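(* Assume that $f$ admits a continuous fourth-order derivative $f^{(4)}$ on $[0,1]$; that $(\gamma_n)\in\mathcal{GS}(-\alpha)$ with $\alpha\in(\frac12,1]$; that $(m_n)\in\mathcal{GS}(a)$ with $a\in(0,1)$; and that $\lim_{n\to\infty}(n\gamma_n)\in\left(\min\left(2a,\frac{\alpha-a}{2}\right),\infty\right]$. Put $\xi=\lim_{n\to\infty}(n\gamma_n)^{-1}$, and let $f_n$ be the recursive Bernstein density estimator with stepsize $(\gamma_n)$ and order $(m_n)$. For $x=0,1$, we have: 1. If $a\in(0,\frac\alpha5]$, then $$\mathrm{Bias}[f_n(x)]=-m_n^{-2}\frac{2}{1-2a\xi}\Delta_2(x)+o(m_n^{-2}).\qquad (\mathrm{B}')$$ If $a\in(\frac\alpha5,1)$, then $$\mathrm{Bias}[f_n(x)]=o\left(\sqrt{\gamma_n m_n}\right).$$ 2. If $a\in[\frac\alpha5,1)$, then $$\mathrm{Var}[f_n(x)]=\frac52\gamma_n m_n\frac{1}{2-(\alpha-a)\xi}f(x)+o(\gamma_n m_n).\qquad (\mathrm{V}')$$ If $a\in(0,\frac\alpha5)$, then $$\mathrm{Var}[f_n(x)]=o(m_n^{-4}).$$ 3. If $\lim_{n\to\infty}(n\gamma_n)>\max\left(2a,\frac{\alpha-a}{2}\right)$ (so that $\lim_{n\to\infty}(n\gamma_n)>2a$ and $\lim_{n\to\infty}(n\gamma_n)>\frac{\alpha-a}{2}$), then $1-2a\xi>0$ and $2-(\alpha-a)\xi>0$, and (B$'$) and (V$'$) hold simultaneously. 4.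 If $a\in(0,\frac\alpha5)$, then $$\mathrm{MSE}[f_n(x)]=\Delta_2^2(x)m_n^{-4}\frac{4}{(1-2a\xi)^2}+o(m_n^{-4}).$$ If $a=\frac\alpha5$, then $$\mathrm{MSE}[f_n(x)]=\Delta_2^2(x)m_n^{-4}\frac{4}{(1-2a\xi)^2}+\frac52f(x)\gamma_n m_n\frac{1}{2-(\alpha-a)\xi}+o\left(m_n^{-4}+\gamma_n m_n\right).$$ If $a\in(\frac\alpha5,1)$, then $$\mathrm{MSE}[f_n(x)]=\frac52f(x)\gamma_n m_n\frac{1}{2-(\alpha-a)\xi}+o(\gamma_n m_n).$$
   Context: Class $\mathcal{GS}$: for $\gamma\in\mathbb{R}$, a nonrandom positive sequence $(v_n)_{n\ge1}$ belongs to $\mathcal{GS}(\gamma)$ if $\lim_{n\to\infty}n\left[1-\frac{v_{n-1}}{v_n}\right]=\gamma$. Estimator: $X_1,X_2,\dots$ are i.i.d. random variables with common unknown density $f$ supported on $[0,1]$. Let $b_k(m,x)=\binom mk x^k(1-x)^{m-k}$ be the Bernstein polynomial of order $m$, and set $$T_{n,m}(x)=m\sum_{k=0}^{m-1}\mathbb{I}\left\{\tfrac km<X_n\le\tfrac{k+1}m\right\}b_k(m-1,x).$$ Given a stepsize sequence $(\gamma_n)$ and an order sequence $(m_n)$, put $Z_n(x)=2T_{n,m}(x)-T_{n,m/2}(x)$ with $m=m_n$. The recursive estimator is defined by $f_0(x)=0$ and, for $n\ge1$, $f_n(x)=(1-\gamma_n)f_{n-1}(x)+\gamma_nZ_n(x)$.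 Notation: $\mathrm{Bias}[f_n(x)]=\mathbb{E}[f_n(x)]-f(x)$; $\mathrm{MSE}[f_n(x)]=\mathbb{E}[(f_n(x)-f(x))^2]$; $$\Delta_2(x)=\tfrac16(1-6x(1-x))f''(x)+\tfrac5{12}x(1-x)(1-2x)f^{(3)}(x)+\tfrac18x^2(1-x)^2f^{(4)}(x).$$ Asymptotic statements are as $n\to\infty$. *)

(* Defs.v *)
From HB Require Import structures.
From mathcomp Require Export all_boot all_order all_algebra finmap.
From mathcomp Require Export all_classical all_reals all_analysis.

Set Implicit Arguments.
Unset Strict Implicit.
Unset Printing Implicit Defensive.

Export Order.TTheory GRing.Theory Num.Theory.
Export numFieldNormedType.Exports.

Local Open Scope classical_set_scope.
Local Open Scope ring_scope.

(* Sequences are indexed from 1: the value v 0 only enters through the term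
   n = 1, hence not in the limit. *)
Definition GS (R : realType) (g : R) (v : nat -> R) : Prop :=
  (forall n, (1 <= n)%N -> 0 < v n) /\
  n%:R * (1 - v n.-1 / v n) @[n --> \oo] --> g.

(* Derivatives relative to A, so that they are one-sided at the end points of
   an interval: a density supported on [0, 1] is in general not even continuous
   at 0 and 1 as a function on the whole line. *)
Definition diff_quot (R : realType) (f : R -> R) (x y : R) : R :=
  (f y - f x) / (y - x).

Definition derivable_within (R : realType) (A : set R) (f : R -> R) (x : R) :
    Prop :=
  cvg (diff_quot f x y @[y --> within A x^']).

Definition derive_within (R : realType) (A : set R) (f : R -> R) (x : R) : R :=
  lim (diff_quot f x y @[y --> within A x^']).

Definition derive_within_n (R : realType) (A : set R) (n : nat) (f : R -> R) :
    R -> R :=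
  iter n (derive_within A) f.

Definition Cn_within (R : realType) (A : set R) (n : nat) (f : R -> R) : Prop :=
  (forall k x, (k < n)%N -> A x -> derivable_within A (derive_within_n A k f) x)
  /\ {within A, continuous (derive_within_n A n f)}.

Definition mutually_independent d (T : measurableType d) (R : realType)
    (P : probability T R) (I : set nat) (X : nat -> {RV P >-> R}) : Prop :=
  forall (J : {fset nat}) (A : nat -> set R),
    [set` J] `<=` I ->
    (forall i, i \in J -> measurable (A i)) ->
    P (\bigcap_(i in [set` J]) (X i @^-1` A i)) =
      (\prod_(i <- J) P (X i @^-1` A i))%E.

(* f is genuinely a function here, not a class of functions up to null sets:
   the claims are about its values at given points. *)
Definition has_density d (T : measurableType d) (R : realType)
    (P : probability T R) (X : {RV P >-> R}) (f : R -> R) : Prop :=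
  [/\ measurable_fun setT f, forall t, 0 <= f t &
      forall A : set R, measurable A ->
        distribution P X A = (\int[lebesgue_measure]_(t in A) (f t)%:E)%E].

Definition bernstein (R : realType) (k m : nat) (x : R) : R :=
  'C(m, k)%:R * x ^+ k * (1 - x) ^+ (m - k).

(* The observation y stands for X_n, and the boolean test for its indicator. *)
Definition Tstat (R : realType) (m : nat) (x y : R) : R :=
  m%:R * \sum_(k < m)
    (k%:R / m%:R < y <= k.+1%:R / m%:R)%R%:R * bernstein k m.-1 x.

Definition Zstat (R : realType) (m : nat) (x y : R) : R :=
  2 * Tstat m x y - Tstat m./2 x y.

Fixpoint rec_estimator d (T : measurableType d) (R : realType)
    (P : probability T R) (X : nat -> {RV P >-> R}) (gam : nat -> R)
    (m : nat -> nat) (x : R) (n : nat) (w : T) : R :=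
  if n is n'.+1 then
    (1 - gam n) * rec_estimator X gam m x n' w
    + gam n * Zstat (m n) x (X n w)
  else 0.

Definition Bias d (T : measurableType d) (R : realType) (P : probability T R)
    (Y : T -> R) (theta : R) : R :=
  fine 'E_P[Y] - theta.

Definition Var d (T : measurableType d) (R : realType) (P : probability T R)
    (Y : T -> R) : R :=
  fine 'V_P[Y].

Definition MSE d (T : measurableType d) (R : realType) (P : probability T R)
    (Y : T -> R) (theta : R) : R :=
  fine 'E_P[(fun w => (Y w - theta) ^+ 2)].

Definition Delta2 (R : realType) (f : R -> R) (x : R) : R :=
  let D k := derive_within_n `[0, 1] k f x in
  6^-1 * (1 - 6 * x * (1 - x)) * D 2%N
  + 5 / 12 * x * (1 - x) * (1 - 2 * x) * D 3%N
  + 8^-1 * x ^+ 2 * (1 - x) ^+ 2 * D 4%N.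

(* Main.v *)
Require Import Defs.
From mathcomp Require Import ring lra.

(** Write e_n = E[Z_n(x)] - f(x). Since f_n is an average of f_(n-1) and of the
    input Z_n, and since the inputs are uncorrelated, the bias b_n and the
    variance var_n of f_n satisfy
    [b_n = (1 - gam_n) b_(n-1) + gam_n e_n] and
    [var_n = (1 - gam_n)^2 var_(n-1) + gam_n^2 Var(Z_n)]
    ([averaging_moments]); the mean squared error is var_n + b_n^2
    ([MSE_decomposition]).

    At an end point x only one Bernstein polynomial is nonzero, so that Z_n(x)
    is a combination of the indicators that X_n lies in the cells of length
    1/m and 2/m next to x ([Zstat_edge]). A second-order Taylor expansion of f
    at x ([taylor2_within]), integrated over a cell ([Rintegral_edge_cell]),
    gives P(X_n in the cell of length h) up to o(h^3). The combination defining
    Z_n cancels the first-order term of its mean, and this yields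
    m^2 e_n -> - 2 Delta_2(x) and Var(Z_n) / m -> 5/2 f(x)
    ([extrapolation_asymptotics]).

    It remains to solve the recursions asymptotically ([GS_recursion]). Suppose
    that [b_n = q_n b_(n-1) + gam_n s_n] with [(1 - q_n) / gam_n -> c], and let
    [v] be in GS(g) with [v_n s_n -> s]. Then [w_n = v_n b_n] satisfies
    [w_n = (1 - theta_n) w_(n-1) + gam_n v_n s_n], where
    [theta_n / gam_n -> c - g xi] because [v_n / v_(n-1) = 1 + g/n + o(1/n)]
    and [1/n = gam_n (xi + o(1))]. If c - g xi > 0, then w_n is eventually
    an average of w_(n-1) and a sequence converging to s / (c - g xi), with
    weights theta_n of divergent sum because they are bounded below by a
    multiple of 1/n; hence w_n has that limit ([averaging_cvg]). The limits of
    the bias and of the variance are instances of this, for v_n one of mu_n^2,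
    mu_n^4, (gam_n mu_n)^-1 and (gam_n mu_n)^(-1/2); the position of a with
    respect to alpha / 5 decides which terms are negligible. *)

Set Implicit Arguments.
Unset Strict Implicit.
Unset Printing Implicit Defensive.

Local Open Scope classical_set_scope.
Local Open Scope ring_scope.

(** * Averaging recursions and the classes GS *)

Section recursion.
Variable R : realType.
Implicit Types (u v w r theta gam : nat -> R).

Lemma cvg_invn : (n%:R : R)^-1 @[n --> \oo] --> (0 : R).
Proof. by rewrite -cvg_shiftS; exact: cvg_harmonic. Qed.

Lemma cvg_eq_near (f g : nat -> R) (l : R) :
  (\forall n \near \oo, f n = g n) -> f n @[n --> \oo] --> l ->
  g n @[n --> \oo] --> l.
Proof.
move=> fg; apply: cvg_trans; apply: near_eq_cvg.
by apply: filterS fg => n ->.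
Qed.

Lemma seq_cvgD (f g : nat -> R) (k l : R) :
  f n @[n --> \oo] --> k -> g n @[n --> \oo] --> l ->
  f n + g n @[n --> \oo] --> k + l.
Proof. by move=> fk gl; exact: cvgD. Qed.

Lemma seq_cvgB (f g : nat -> R) (k l : R) :
  f n @[n --> \oo] --> k -> g n @[n --> \oo] --> l ->
  f n - g n @[n --> \oo] --> k - l.
Proof. by move=> fk gl; exact: cvgB. Qed.

Lemma seq_cvgM (f g : nat -> R) (k l : R) :
  f n @[n --> \oo] --> k -> g n @[n --> \oo] --> l ->
  f n * g n @[n --> \oo] --> k * l.
Proof. by move=> fk gl; exact: cvgM. Qed.

Lemma seq_cvgN (f : nat -> R) (k : R) :
  f n @[n --> \oo] --> k -> - f n @[n --> \oo] --> - k.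
Proof. by move=> fk; exact: cvgN. Qed.

Lemma seq_cvgV (f : nat -> R) (k : R) : k != 0 ->
  f n @[n --> \oo] --> k -> (f n)^-1 @[n --> \oo] --> k^-1.
Proof. by move=> k0 fk; exact: cvgV. Qed.

Lemma seq_cvgc (k : R) : (fun=> k) n @[n --> \oo] --> k.
Proof. exact: cvg_cst. Qed.

Lemma near_ge1 : \forall n \near \oo, (0 < n)%N.
Proof. exact: nbhs_infty_gt. Qed.

Lemma near_pred_ge1 : \forall n \near \oo, (0 < n.-1)%N.
Proof. by exists 2 => // -[|[]]. Qed.

(** The product of the factors 1 - theta_k tends to 0: it is at most
    (1 + sum of the theta_k)^-1, and the harmonic series diverges. *)
Lemma contraction_cvg0 theta u (c : R) :
  0 < c ->
  (\forall n \near \oo, c / n%:R <= theta n <= 1) ->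
  (\forall n \near \oo, 0 <= u n <= (1 - theta n) * u n.-1) ->
  u n @[n --> \oo] --> 0.
Proof.
move=> c0 [N1 _ th] [N2 _ hu].
pose N := (maxn N1 N2).+1.
have thN k : (N <= k)%N -> c / k%:R <= theta k <= 1.
  by move=> Nk; apply: th => /=; rewrite (leq_trans _ Nk)// /N leqW// leq_maxl.
have uN k : (N <= k)%N -> 0 <= u k <= (1 - theta k) * u k.-1.
  by move=> Nk; apply: hu => /=; rewrite (leq_trans _ Nk)// /N leqW// leq_maxr.
pose S k := \sum_(0 <= i < k) c * harmonic (i + N) : R.
have S0 k : 0 <= S k.
  by apply: sumr_ge0 => i _; rewrite mulr_ge0 ?ltW ?harmonic_gt0.
have bnd k : u (k + N)%N * (1 + S k) <= u N.
  elim: k => [|k IH]; first by rewrite /S big_geq// addr0 mulr1 add0n.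
  rewrite addSn; have kN : (N <= (k + N).+1)%N by rewrite leqW// leq_addl.
  have /andP[t1 t2] := thN _ kN; have /andP[u0 u1] := uN _ kN.
  rewrite /= in u1; rewrite /S big_nat_recr//= -/(S k).
  set t := theta _ in t1 t2 u1.
  have uk : 0 <= u (k + N)%N by have /andP[] := uN _ (leq_addl k N).
  have ch : 0 <= c * harmonic (k + N) :> R.
    by rewrite mulr_ge0 ?ltW ?harmonic_gt0.
  have {}t1 : c * harmonic (k + N) <= t by [].
  have Sk := S0 k.
  set h := c * harmonic _ in ch t1 *.
  apply: le_trans IH.
  apply: (@le_trans _ _ ((1 - t) * u (k + N)%N * (1 + (S k + h)))).
    by rewrite ler_wpM2r//; lra.
  rewrite -mulrA mulrCA ler_wpM2l//.
  nra.
(* S k dominates c times a block of the harmonic series *)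
have Sy : S k @[k --> \oo] --> +oo.
  have hy : series (@harmonic R) n @[n --> \oo] --> +oo.
    apply: nondecreasing_dvgn_lt; last exact: dvg_harmonic.
    apply/nondecreasing_seqP => n.
    by rewrite /series/= big_nat_recr//= lerDl ltW// invr_gt0.
  apply/cvgryPge => A.
  move/cvgryPge/(_ (A / c + series harmonic N)): hy.
  case=> M _ hM; exists M => // n /= Mn.
  have := hM (n + N)%N (leq_trans Mn (leq_addr _ _)).
  rewrite /= -lerBrDr => An.
  suff -> : S n = c * (series harmonic (n + N)%N - series harmonic N).
    by rewrite mulrC -ler_pdivrMr.
  rewrite sub_series_geq ?leq_addl// /S -mulr_sumr addnC -{2}[N]add0n.
  by rewrite big_addn addKn.
rewrite -(cvg_shiftn N); apply/cvgrPdist_le => e e0.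
move/cvgryPge/(_ (u N / e)): Sy; apply: filterS => n Sn /=.
have /andP[u0 _] := uN _ (leq_addl n N).
rewrite sub0r normrN ger0_norm//.
have S1 : 0 < 1 + S n by rewrite ltr_wpDr.
rewrite -(ler_pM2r S1) (le_trans (bnd n))//.
move: Sn; rewrite ler_pdivrMr// => Sn; nra.
Qed.

(** The weights theta_n have a divergent sum, so that the averages forget their
    initial value and follow r_n. *)
Lemma averaging_cvg theta u r (c l : R) :
  0 < c ->
  (\forall n \near \oo, c / n%:R <= theta n <= 1) ->
  (\forall n \near \oo, u n = (1 - theta n) * u n.-1 + theta n * r n) ->
  r n @[n --> \oo] --> l ->
  u n @[n --> \oo] --> l.
Proof.
move=> c0 hth hu /cvgrPdist_le hr; apply/cvgrPdist_le => e e0.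
have e2 : 0 < e / 2 by rewrite divr_gt0.
(* the part of the error in excess of e / 2 is a contraction *)
pose y n := Num.max 0 (`|u n - l| - e / 2).
have : y n @[n --> \oo] --> 0.
  apply: (contraction_cvg0 c0 hth).
  have {}hr := hr _ e2.
  near=> n.
  have rl : `|l - r n| <= e / 2 by near: n.
  have n0 : (0 < n)%N by near: n; exact: near_ge1.
  have /andP[t0 t1] : c / n%:R <= theta n <= 1 by near: n.
  have {}t0 : 0 <= theta n by rewrite (le_trans _ t0)// divr_ge0// ltW.
  have s0 : 0 <= 1 - theta n by rewrite subr_ge0.
  rewrite /y; apply/andP; split; first by rewrite le_max lexx.
  have -> : u n = (1 - theta n) * u n.-1 + theta n * r n by near: n.
  rewrite ge_max; apply/andP; split; first by rewrite mulr_ge0// le_max lexx.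
  have -> : (1 - theta n) * u n.-1 + theta n * r n - l =
            (1 - theta n) * (u n.-1 - l) + theta n * (r n - l) by ring.
  rewrite lerBlDr (le_trans (ler_normD _ _))// !normrM.
  rewrite (ger0_norm s0) (ger0_norm t0) (distrC (r n) l).
  have : (1 - theta n) * (`|u n.-1 - l| - e / 2) <=
      (1 - theta n) * Num.max 0 (`|u n.-1 - l| - e / 2).
    by rewrite ler_wpM2l// le_max lexx orbT.
  have : theta n * `|l - r n| <= theta n * (e / 2) by rewrite ler_wpM2l.
  lra.
move/cvgrPdist_le/(_ _ e2); apply: filterS => n.
rewrite sub0r normrN /y (distrC l) => h.
have : Num.max 0 (`|u n - l| - e / 2) <= e / 2.
  exact: le_trans (ler_norm _) h.
by rewrite ge_max => /andP[_]; rewrite lerBlDr -splitr.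
Unshelve. all: by end_near. Qed.

Lemma GS_gt0 g v n : GS g v -> (0 < n)%N -> 0 < v n.
Proof. by case=> v0 _ /v0. Qed.

Lemma GS_ratio g v : GS g v -> v n.-1 / v n @[n --> \oo] --> (1 : R).
Proof.
move=> [v0 hv].
have := seq_cvgM hv cvg_invn; rewrite mulr0 => h.
have := seq_cvgB (@seq_cvgc 1) h; rewrite subr0.
apply: cvg_eq_near; near=> n => /=.
have n0 : (0 < n)%N by near: n; exact: near_ge1.
by rewrite mulrAC divff ?pnatr_eq0 ?lt0n_neq0// mul1r subKr.
Unshelve. all: by end_near. Qed.

Lemma GS_mul g h v w : GS g v -> GS h w -> GS (g + h) (fun n => v n * w n).
Proof.
move=> gv hw; split=> [n n1|].
  by rewrite mulr_gt0 ?(GS_gt0 gv)// (GS_gt0 hw).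
have := seq_cvgD gv.2 (seq_cvgM (GS_ratio gv) hw.2).
rewrite mul1r; apply: cvg_eq_near; near=> n => /=.
have n0 : (0 < n)%N by near: n; exact: near_ge1.
have v0 := GS_gt0 gv n0; have w0 := GS_gt0 hw n0.
by field; rewrite !gt_eqF.
Unshelve. all: by end_near. Qed.

Lemma GS_inv g v : GS g v -> GS (- g) (fun n => (v n)^-1).
Proof.
move=> gv; split=> [n n1|]; first by rewrite invr_gt0 (GS_gt0 gv).
have := seq_cvgM (seq_cvgN gv.2) (seq_cvgV (oner_neq0 _) (GS_ratio gv)).
rewrite invr1 mulr1; apply: cvg_eq_near; near=> n => /=.
have n0 : (0 < n.-1)%N by near: n; exact: near_pred_ge1.
have v0 := GS_gt0 gv n0; have v1 := GS_gt0 gv (leq_trans n0 (leq_pred _)).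
by field; rewrite !gt_eqF.
Unshelve. all: by end_near. Qed.

Lemma GS_sqrt g v : GS g v -> GS (g / 2) (fun n => Num.sqrt (v n)).
Proof.
move=> gv; split=> [n n1|]; first by rewrite sqrtr_gt0 (GS_gt0 gv).
have r1 : Num.sqrt (v n.-1 / v n) @[n --> \oo] --> (1 : R).
  rewrite -[X in _ --> X]sqrtr1.
  exact: (continuous_cvg _ (@sqrt_continuous R 1) (GS_ratio gv)).
have h2 : (1 : R) + 1 != 0 by rewrite -mulr2n pnatr_eq0.
have := seq_cvgM gv.2 (seq_cvgV h2 (seq_cvgD (@seq_cvgc 1) r1)).
apply: cvg_eq_near; near=> n => /=.
have n0 : (0 < n.-1)%N by near: n; exact: near_pred_ge1.
have v0 := GS_gt0 gv n0; have v1 := GS_gt0 gv (leq_trans n0 (leq_pred _)).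
have -> : Num.sqrt (v n.-1) / Num.sqrt (v n) = Num.sqrt (v n.-1 / v n).
  by rewrite sqrtrM ?ltW// sqrtrV ?ltW.
set s := Num.sqrt (_ / _).
have -> : v n.-1 / v n = s ^+ 2 by rewrite sqr_sqrtr// divr_ge0// ltW.
have s0 : 0 <= s by exact: sqrtr_ge0.
by field; rewrite gt_eqF// ltr_wpDr.
Unshelve. all: by end_near. Qed.

Lemma GS_id : GS 1 (fun n => n%:R : R).
Proof.
split=> [n|]; first by rewrite ltr0n.
apply: (@cvg_eq_near (fun=> 1)); last exact: cvg_cst.
near=> n.
have n0 : (0 < n)%N by near: n; exact: near_ge1.
rewrite -subn1 natrB//; field.
by rewrite pnatr_eq0 -lt0n.
Unshelve. all: by end_near. Qed.

(** If g < 0, then v_n = (1 - theta_n) v_(n-1) with n theta_n -> - g > 0. *)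
Lemma GS_cvg0 g v : g < 0 -> GS g v -> v n @[n --> \oo] --> (0 : R).
Proof.
move=> g0 gv.
have [_ h] := GS_inv gv.
pose theta n := 1 - v n / v n.-1.
have h' : n%:R * theta n @[n --> \oo] --> - g.
  apply: cvg_eq_near h; near=> n; rewrite invrK [_^-1 * _]mulrC //.
apply: (@contraction_cvg0 theta _ (- g / 2)); first by lra.
  have /cvgrPdist_le/(_ (- g / 2)) := h'.
  move=> /(_ ltac:(lra)) hg.
  near=> n.
  have n0 : (0 < n)%N by near: n; exact: near_ge1.
  have n1 : (0 < n.-1)%N by near: n; exact: near_pred_ge1.
  apply/andP; split; last first.
    by rewrite /theta gerBl divr_ge0// ltW// (GS_gt0 gv).
  rewrite ler_pdivrMr ?ltr0n//.
  have : `|- g - n%:R * theta n| <= - g / 2 by near: n.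
  by rewrite ler_norml => /andP[_]; lra.
near=> n.
have n1 : (0 < n.-1)%N by near: n; exact: near_pred_ge1.
have v0 := GS_gt0 gv n1; have v1 := GS_gt0 gv (leq_trans n1 (leq_pred _)).
by rewrite ltW//= /theta subKr divfK// gt_eqF.
Unshelve. all: by end_near. Qed.

(** The asymptotic solution of a first-order linear recursion with stepsize
    gam_n, on the scale of a sequence v in GS(g). *)
Theorem GS_recursion g v gam q s b (c xi s0 : R) :
  GS g v ->
  (forall n, (0 < n)%N -> 0 < gam n) ->
  gam n @[n --> \oo] --> (0 : R) ->
  (n%:R * gam n)^-1 @[n --> \oo] --> xi ->
  0 < c - g * xi ->
  (forall n, (0 < n)%N -> b n = q n * b n.-1 + gam n * s n) ->
  (1 - q n) / gam n @[n --> \oo] --> c ->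
  v n * s n @[n --> \oo] --> s0 ->
  v n * b n @[n --> \oo] --> s0 / (c - g * xi).
Proof.
move=> gv gam0 gamc ngam k0 hb hq hs.
have q1 : q n @[n --> \oo] --> (1 : R).
  have := seq_cvgM hq gamc; rewrite mulr0 => h.
  have := seq_cvgB (@seq_cvgc 1) h; rewrite subr0.
  apply: cvg_eq_near; near=> n => /=.
  have n0 : (0 < n)%N by near: n; exact: near_ge1.
  by rewrite divfK ?gt_eqF ?gam0// subKr.
(* 1 - theta n is the coefficient of v n.-1 * b n.-1 in v n * b n *)
pose theta n := 1 - q n * (v n / v n.-1).
have thg : theta n / gam n @[n --> \oo] --> c - g * xi.
  have := seq_cvgD hq (seq_cvgM q1 (seq_cvgM (GS_inv gv).2 ngam)).
  rewrite mul1r mulNr; apply: cvg_eq_near; near=> n => /=.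
  have n1 : (0 < n.-1)%N by near: n; exact: near_pred_ge1.
  have n0 := leq_trans n1 (leq_pred _).
  have v0 := GS_gt0 gv n1; have v1 := GS_gt0 gv n0.
  have gn0 := gam0 _ n0.
  rewrite /theta; field.
  by rewrite !gt_eqF ?ltr0n.
have th0 : theta n @[n --> \oo] --> (0 : R).
  have := seq_cvgM thg gamc; rewrite mulr0; apply: cvg_eq_near; near=> n => /=.
  have n0 : (0 < n)%N by near: n; exact: near_ge1.
  by rewrite divfK ?gt_eqF ?gam0.
have nth : (n%:R * theta n)^-1 @[n --> \oo] --> xi / (c - g * xi).
  have k1 : c - g * xi != 0 by rewrite gt_eqF.
  have := seq_cvgM ngam (seq_cvgV k1 thg); apply: cvg_eq_near; near=> n => /=.
  have n0 : (0 < n)%N by near: n; exact: near_ge1.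
  by rewrite invf_div mulrA invfM divfK ?gt_eqF ?gam0// -invfM.
have thpos : \forall n \near \oo, 0 < theta n.
  have k2 : 0 < (c - g * xi) / 2 by rewrite divr_gt0.
  have /cvgrPdist_le/(_ _ k2) hk := thg.
  near=> n.
  have n0 : (0 < n)%N by near: n; exact: near_ge1.
  have : `|c - g * xi - theta n / gam n| <= (c - g * xi) / 2 by near: n.
  rewrite ler_norml => /andP[_ h].
  have : 0 < theta n / gam n by lra.
  by rewrite pmulr_lgt0// invr_gt0 gam0.
(* theta_n >= C^-1 / n, since (n theta_n)^-1 tends to xi / (c - g xi) *)
pose C := `|xi / (c - g * xi)| + 1.
have C0 : 0 < C by rewrite ltr_wpDl.
apply: (@averaging_cvg theta _ (fun n => v n * s n / (theta n / gam n)) C^-1).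
- by rewrite invr_gt0.
- have /cvgrPdist_le/(_ 1 ltr01) h1 := th0.
  have /cvgrPdist_le/(_ 1 ltr01) h2 := nth.
  near=> n.
  have n0 : (0 < n)%N by near: n; exact: near_ge1.
  have t0 : 0 < theta n by near: n.
  apply/andP; split; last first.
    have : `|0 - theta n| <= 1 by near: n.
    by rewrite sub0r normrN gtr0_norm.
  have h : `|xi / (c - g * xi) - (n%:R * theta n)^-1| <= 1 by near: n.
  have nt0 : 0 < n%:R * theta n by rewrite mulr_gt0// ltr0n.
  have hC : (n%:R * theta n)^-1 <= C.
    move: h; rewrite ler_norml => /andP[h _].
    have := ler_norm (xi / (c - g * xi)); rewrite /C; lra.
  by rewrite ler_pdivrMr ?ltr0n// mulrC invf_ple ?posrE.
- near=> n.
  have n1 : (0 < n.-1)%N by near: n; exact: near_pred_ge1.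
  have n0 := leq_trans n1 (leq_pred _).
  have v0 := GS_gt0 gv n1; have v1 := GS_gt0 gv n0.
  have t0 : 0 < theta n by near: n.
  have gn0 := gam0 _ n0.
  rewrite (hb n n0).
  have -> : theta n * (v n * s n / (theta n / gam n)) = gam n * (v n * s n).
    by field; rewrite !gt_eqF.
  rewrite /theta subKr; field.
  by rewrite gt_eqF.
- by apply: seq_cvgM hs _; apply: seq_cvgV thg; rewrite gt_eqF.
Unshelve. all: by end_near. Qed.

End recursion.

(** * Taylor expansion and integrals over cells next to an end point *)

Section taylor.
Variable R : realType.
Implicit Types (f : R -> R) (x y t h : R).

Lemma derive_within_dist (A : set R) f x e :
  derivable_within A f x -> 0 < e ->
  exists2 dl, 0 < dl & forall y, A y -> `|y - x| < dl ->
    `|f y - f x - derive_within A f x * (y - x)| <= e * `|y - x|.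
Proof.
move=> fx e0.
have : diff_quot f x y @[y --> within A x^'] --> derive_within A f x by [].
move=> /cvgrPdist_le/(_ _ e0).
rewrite near_withinE => /nbhs_ballP[dl /= dl0 hdl].
exists dl => // y Ay yx.
have [->|yx0] := eqVneq y x; first by rewrite !subrr mulr0 subr0 normr0 mulr0.
have := hdl y; rewrite /ball/= distrC => /(_ yx yx0 Ay).
have yx0' : y - x != 0 by rewrite subr_eq0.
have -> : f y - f x - derive_within A f x * (y - x) =
    - (derive_within A f x - diff_quot f x y) * (y - x).
  by rewrite /diff_quot; field.
by rewrite normrM normrN => h; rewrite ler_wpM2r.
Qed.

(** At an interior point, the derivative relative to [a, b] is the ordinary
    one. *)
Lemma derivable_within_is_derive (a b : R) f t :
  derivable_within `[a, b] f t -> t \in `]a, b[ ->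
  is_derive t 1 f (derive_within `[a, b] f t).
Proof.
move=> ft; rewrite in_itv/= => /andP[ta tb].
have : h^-1 *: ((f \o shift t) (h *: (1 : R)) - f t) @[h --> 0^'] -->
    derive_within `[a, b] f t.
  apply/cvgrPdist_le => e e0.
  have [dl dl0 hdl] := derive_within_dist ft e0.
  near=> h.
  have h0 : h != 0 by near: h; exact: nbhs_dnbhs_neq.
  rewrite /= /shift/= -![_ *: _]/(_ * _) mulr1.
  have : `|h| < Num.min dl (Num.min (t - a) (b - t)).
    near: h; apply: dnbhs0_lt.
    by rewrite !lt_min dl0 !subr_gt0 ta.
  rewrite !lt_min => /and3P[h1 h2 h3].
  have := hdl (h + t); rewrite addrK => /(_ _ h1).
  have hn := ler_norm h; have hn' := lerNnormlW (lexx `|h|).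
  rewrite /= in_itv/= => /(_ ltac:(apply/andP; split; lra)).
  have -> : derive_within `[a, b] f t - h^-1 * (f (h + t) - f t) =
    - (f (h + t) - f t - derive_within `[a, b] f t * h) * h^-1 by field.
  by rewrite normrM normrN normfV ler_pdivrMr// normr_gt0.
move=> hc; split; first exact: cvgP hc.
exact: cvg_lim hc.
Unshelve. all: by end_near. Qed.

Lemma derivable_within_continuous_within (A : set R) f :
  (forall x, A x -> derivable_within A f x) -> {within A, continuous f}.
Proof.
move=> fA; apply/subspace_continuousP => x Ax.
have [dl dl0 hdl] := derive_within_dist (fA x Ax) ltr01.
set D := derive_within A f x in hdl.
apply/cvgrPdist_le => e e0.
have D1 : 0 < 1 + `|D| by rewrite ltr_wpDr.
rewrite near_withinE; apply/nbhs_ballP.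
exists (Num.min dl (e / (1 + `|D|))) => /=.
  by rewrite lt_min dl0/= divr_gt0.
move=> y; rewrite /ball/= lt_min distrC => /andP[y1 y2] Ay.
have := hdl y Ay y1; rewrite mul1r => hy.
move: y2; rewrite ltr_pdivlMr// => y2.
have : `|f y - f x| <= `|f y - f x - D * (y - x)| + `|D * (y - x)|.
  by rewrite -{1}[f y - f x](subrK (D * (y - x))) ler_normD.
rewrite normrM distrC; have := normr_ge0 (y - x); nra.
Qed.

(** The polynomial of degree at most 3 with the given coefficients in the powers
    of t - c. *)
Definition cubic (c : R) (k0 k1 k2 k3 t : R) :=
  k0 + k1 * (t - c) + k2 * (t - c) ^+ 2 + k3 * (t - c) ^+ 3.

Lemma is_derive_cubic c k0 k1 k2 k3 t :
  is_derive t (1 : R) (cubic c k0 k1 k2 k3) (cubic c k1 (2 * k2) (3 * k3) 0 t).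
Proof.
have dB : is_derive t (1 : R) (fun t : R => t - c) 1.
  by apply: is_derive_eq; rewrite subr0.
have -> : cubic c k0 k1 k2 k3 = cst k0 + k1 \*: (fun t : R => t - c)
    + k2 \*: (fun t : R => t - c) ^+ 2 + k3 \*: (fun t : R => t - c) ^+ 3.
  by apply/funext => u.
apply: is_derive_eq.
rewrite /cubic -![_ *: _]/(_ * _) /= expr1; ring.
Qed.

Lemma continuous_cubic c k0 k1 k2 k3 : continuous (cubic c k0 k1 k2 k3).
Proof.
move=> t; apply: differentiable_continuous; apply/derivable1_diffP.
by have := is_derive_cubic c k0 k1 k2 k3 t; case.
Qed.

(** Second-order Taylor-Peano formula, valid at the end points too: the mean
    value theorem reduces it to the differentiability at x of the first
    derivative. *)
Lemma taylor2_within (a b : R) f x e :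
  (forall t, t \in `[a, b] -> derivable_within `[a, b] f t) ->
  derivable_within `[a, b] (derive_within `[a, b] f) x ->
  x \in `[a, b] -> 0 < e ->
  let D1 := derive_within `[a, b] f x in
  let D2 := derive_within `[a, b] (derive_within `[a, b] f) x in
  exists2 dl, 0 < dl & forall t, t \in `[a, b] -> `|t - x| < dl ->
    `|f t - cubic x (f x) D1 (D2 / 2) 0 t| <= e * (t - x) ^+ 2.
Proof.
move=> df d2f xab e0 D1 D2.
have [dl dl0 hdl] := derive_within_dist d2f e0.
exists dl => // t tab tx.
pose g t := f t - cubic x (f x) D1 (D2 / 2) 0 t.
pose dg t := derive_within `[a, b] f t - cubic x D1 D2 0 0 t.
have gx : g x = 0 by rewrite /g /cubic; ring.
have cf : {within `[a, b], continuous f}.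
  by apply: derivable_within_continuous_within.
(* the mean value theorem on a subsegment of [a, b] *)
have mvt u v : u <= v -> u \in `[a, b] -> v \in `[a, b] ->
    exists2 c, c \in `[u, v]%R & g v - g u = dg c * (v - u).
  move=> uv; rewrite !in_itv/= => /andP[au ub] /andP[av vb].
  apply: MVT_segment => // [z|].
    rewrite in_itv/= => /andP[uz zv].
    have zab : z \in `]a, b[ by rewrite in_itv/=; apply/andP; split; lra.
    have zab' : z \in `[a, b] by rewrite /= in_itv/=; apply/andP; split; lra.
    have fz := derivable_within_is_derive (df _ zab') zab.
    have qz := is_derive_cubic x (f x) D1 (D2 / 2) 0 z.
    have := is_deriveB fz qz.
    by rewrite mulrCA divff ?pnatr_eq0// mulr1 mulr0.
  have cf' : {within `[u, v], continuous f}.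
    apply: continuous_subspaceW cf => z /=; rewrite !in_itv/= => /andP[? ?].
    by apply/andP; split; lra.
  move=> z; apply: continuousB; first exact: cf'.
  by move: z; apply: continuous_subspaceT; exact: continuous_cubic.
have [c [c1 c2] hc] : exists2 c, c \in `[a, b] /\ `|c - x| <= `|t - x| &
    g t = dg c * (t - x).
  have := xab; have := tab; rewrite !in_itv/= => /andP[t0 t1] /andP[x0 x1].
  have [xt|/ltW xt] := leP x t.
    have [c + hc] := mvt _ _ xt xab tab; rewrite in_itv/= => /andP[xc ct].
    exists c; last by rewrite -hc gx subr0.
    rewrite in_itv/= !ger0_norm ?subr_ge0// lerB//; split => //.
    by apply/andP; split; lra.
  have [c + hc] := mvt _ _ xt tab xab; rewrite in_itv/= => /andP[tc cx].
  exists c; last by move: hc; rewrite gx; lra.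
  rewrite in_itv/= !ler0_norm ?subr_le0// lerN2 lerB//; split => //.
  by apply/andP; split; lra.
have /= := hdl c c1 (le_lt_trans c2 tx).
rewrite -/D2 => hcx.
rewrite -/(g t) hc normrM /dg.
have -> : derive_within `[a, b] f c - cubic x D1 D2 0 0 c =
   derive_within `[a, b] f c - D1 - D2 * (c - x) by rewrite /cubic; ring.
rewrite -real_normK ?num_real// expr2 mulrA ler_wpM2r//.
by rewrite (le_trans hcx)// ler_wpM2l// ltW.
Qed.

Lemma integrable_within (u v : R) f : {within `[u, v], continuous f} ->
  lebesgue_measure.-integrable `]u, v] (EFin \o f).
Proof.
move=> cf.
have : lebesgue_measure.-integrable `[u, v] (EFin \o f).
  by apply: continuous_compact_integrable => //; exact: segment_compact.
by apply: integrableS => //; exact: subset_itv_oc_cc.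
Qed.

Lemma Rintegral_cubic_itv c k0 k1 k2 (u v : R) : u < v ->
  \int[lebesgue_measure]_(t in `]u, v]) cubic c k0 k1 k2 0 t =
  cubic c 0 k0 (k1 / 2) (k2 / 3) v - cubic c 0 k0 (k1 / 2) (k2 / 3) u :> R.
Proof.
move=> uv.
have cq : {within `[u, v], continuous (cubic c k0 k1 k2 0)}.
  by apply: continuous_subspaceT; exact: continuous_cubic.
rewrite Rintegral_itv_obnd_cbnd; last exact: integrable_within.
pose G := cubic c 0 k0 (k1 / 2) (k2 / 3).
have dG t : is_derive t (1 : R) G (cubic c k0 k1 k2 0 t).
  apply: is_derive_eq (is_derive_cubic _ _ _ _ _ _) _.
  by rewrite /cubic; field.
rewrite /Rintegral (@continuous_FTC2 _ _ G)//.
- split=> [z _|| ]; first by case: (dG z).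
  + by apply: cvg_at_right_filter; exact: continuous_cubic.
  + by apply: cvg_at_left_filter; exact: continuous_cubic.
- by move=> z _; rewrite derive1E; exact: derive_val.
Qed.

(** The subinterval of [0, 1] of length h next to the end point x: ]0, h] for
    x = 0 and ]1 - h, 1] for x = 1. *)
Definition edge_cell x h : set R := `](1 - h) * x, (1 - h) * x + h].

(** The factor 1 - 2 x is the sign with which t - x enters: 1 at x = 0 and -1 at
    x = 1. *)
Lemma Rintegral_edge_cell f x e :
  (forall t, t \in `[0, 1] -> derivable_within `[0, 1] f t) ->
  derivable_within `[0, 1] (derive_within `[0, 1] f) x ->
  x = 0 \/ x = 1 -> 0 < e ->
  let D1 := derive_within `[0, 1] f x in
  let D2 := derive_within `[0, 1] (derive_within `[0, 1] f) x in
  exists2 dl, 0 < dl & forall h, 0 < h -> h < dl -> h <= 1 ->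
    `|\int[lebesgue_measure]_(t in edge_cell x h) f t -
      (f x * h + (1 - 2 * x) * D1 / 2 * h ^+ 2 + D2 / 6 * h ^+ 3)| <=
    e * h ^+ 3.
Proof.
move=> df d2f x01 e0 D1 D2.
have xI : x \in `[0, 1].
  by rewrite in_itv/=; case: x01 => ->; apply/andP; split; lra.
have [dl dl0 hdl] := taylor2_within df d2f xI e0.
exists dl => // h h0 hd h1.
set q := cubic x (f x) D1 (D2 / 2) 0 in hdl.
have bnd t : edge_cell x h t -> t \in `[0, 1] /\ `|t - x| <= h.
  rewrite /edge_cell /= !in_itv/= ler_norml => /andP[].
  by case: x01 => ->; split; apply/andP; split; lra.
have uv : (1 - h) * x < (1 - h) * x + h by rewrite ltrDl.
have cf : {within `[(1 - h) * x, (1 - h) * x + h], continuous f}.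
  apply: continuous_subspaceW (derivable_within_continuous_within df).
  move=> t /=; rewrite !in_itv/= => /andP[].
  by case: x01 => -> *; apply/andP; split; lra.
have cq : {within `[(1 - h) * x, (1 - h) * x + h], continuous q}.
  by apply: continuous_subspaceT; exact: continuous_cubic.
have if1 := integrable_within cf.
have iq := integrable_within cq.
have -> : f x * h + (1 - 2 * x) * D1 / 2 * h ^+ 2 + D2 / 6 * h ^+ 3 =
    \int[lebesgue_measure]_(t in edge_cell x h) q t.
  rewrite /edge_cell Rintegral_cubic_itv// /cubic.
  by case: x01 => ->; field.
have mC : measurable (edge_cell x h : set (measurableTypeR R)).
  exact: measurable_itv.
rewrite -RintegralB//.
have ifq : lebesgue_measure.-integrable (edge_cell x h)
    (EFin \o (fun t => f t - q t)).
  by have := integrableB mC if1 iq.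
rewrite (le_trans (le_normr_Rintegral mC ifq))//.
apply: (@le_trans _ _
   (\int[lebesgue_measure]_(t in edge_cell x h) (e * h ^+ 2))).
  apply: le_Rintegral => //.
  - exact: integrable_norm.
  - have := @integrable_within _ _ (cst (e * h ^+ 2)) _; apply.
    by apply: continuous_subspaceT => ?; exact: cst_continuous.
  move=> t /bnd[tI th].
  apply: (le_trans (hdl t tI (le_lt_trans th hd))).
  apply: ler_wpM2l (ltW e0) _ _ _; rewrite -[leLHS]real_normK ?num_real//.
  by rewrite lerXn2r ?nnegrE// ltW.
rewrite Rintegral_cst//= /edge_cell lebesgue_measure_itv/= lte_fin uv -EFinD/=.
by rewrite [_ + h]addrC addrK -mulrA -exprSr.
Qed.

End taylor.

(** * Moments of averages of uncorrelated random variables *)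

Section moments.
Context d (T : measurableType d) (R : realType) (P : probability T R).
Implicit Types (U V W : T -> R) (a b : R) (E F : set T).

Lemma Lfun2_1 U : U \in Lfun P 2%:E -> U \in Lfun P 1.
Proof. by apply: Lfun_subset12; exact: fin_num_measure. Qed.

Lemma Lfun2_indic E : measurable E -> (\1_E : T -> R) \in Lfun P 2%:E.
Proof.
move=> mE; rewrite inE/=; apply/andP; split; rewrite inE/=.
  exact: measurable_realfun.measurable_indic.
rewrite /finite_norm unlock poweR_lty//.
rewrite (eq_integral (fun w => (\1_E w)%:E))//.
  by rewrite integral_indic// setIT (le_lt_trans (probability_le1 P mE))// ltry.
move=> w _; rewrite /= indicE; case: (w \in E).
  by rewrite mulr1n normr1 powR1.
by rewrite mulr0n normr0 powR0.
Qed.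

Lemma lincombE a b U V :
  (fun w => a * U w + b * V w) = (a \o* U) \+ (b \o* V).
Proof. by apply/funext => w /=; rewrite (mulrC (U w)) (mulrC (V w)). Qed.

Lemma Lfun2_lincomb a b U V : U \in Lfun P 2%:E -> V \in Lfun P 2%:E ->
  (fun w => a * U w + b * V w) \in Lfun P 2%:E.
Proof.
move=> U2 V2; rewrite lincombE.
have aU : a \o* U \in Lfun P 2%:E by rewrite Lfun_scale// ler1n.
have bV : b \o* V \in Lfun P 2%:E by rewrite Lfun_scale// ler1n.
by rewrite rpredD ?lee1n.
Qed.

Lemma mean_lincomb a b U V : U \in Lfun P 2%:E -> V \in Lfun P 2%:E ->
  fine 'E_P[fun w => (a * U w + b * V w)%R] =
  a * fine 'E_P[U] + b * fine 'E_P[V].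
Proof.
move=> /Lfun2_1 U2 /Lfun2_1 V2; rewrite lincombE.
rewrite expectationD ?Lfun_scale// !expectationZl//.
by rewrite fineD ?fin_numM ?fineM ?expectation_fin_num.
Qed.

Lemma covariance_lincomb a b U V W :
  U \in Lfun P 2%:E -> V \in Lfun P 2%:E -> W \in Lfun P 2%:E ->
  covariance P U W = 0 -> covariance P V W = 0 ->
  covariance P (fun w => a * U w + b * V w) W = 0.
Proof.
move=> U2 V2 W2 cU cV; rewrite lincombE.
rewrite covarianceDl ?Lfun_scale ?ler1n//.
by rewrite !covarianceZl ?cU ?cV ?mule0 ?adde0 ?Lfun2_mul_Lfun1 ?Lfun2_1.
Qed.

Lemma variance_lincomb a b U V : U \in Lfun P 2%:E -> V \in Lfun P 2%:E ->
  covariance P U V = 0 ->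
  fine 'V_P[fun w => (a * U w + b * V w)%R] =
  a ^+ 2 * fine 'V_P[U] + b ^+ 2 * fine 'V_P[V].
Proof.
move=> U2 V2 cUV; rewrite lincombE.
rewrite varianceD ?Lfun_scale ?ler1n//.
have aU : a \o* U \in Lfun P 2%:E by rewrite Lfun_scale// ler1n.
have bV : b \o* V \in Lfun P 2%:E by rewrite Lfun_scale// ler1n.
have bV1 := Lfun2_1 bV.
rewrite covarianceZl ?covarianceZr ?cUV ?bV1 ?mule0 ?adde0 ?Lfun2_mul_Lfun1//;
  rewrite ?Lfun2_1//.
rewrite !varianceZ//.
by rewrite fineD ?fin_numM ?fineM ?variance_fin_num.
Qed.

Lemma MSE_decomposition U theta : U \in Lfun P 2%:E ->
  MSE P U theta = Var P U + Bias P U theta ^+ 2.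
Proof.
move=> U2.
have U2' : (U \- cst theta) \in Lfun P 2%:E.
  by rewrite rpredB ?lee1n//= ?U2 ?Lfun_cst.
have := varianceE U2'; rewrite varianceB_cst_r//.
rewrite expectationB ?Lfun2_1 ?Lfun_cst// expectation_cst.
rewrite /MSE /Var /Bias => ->.
have fE : ('E_P[U])%E \is a fin_num by rewrite expectation_fin_num// Lfun2_1.
have fS : ('E_P[(U \- cst theta)%R ^+ 2])%E \is a fin_num.
  by rewrite expectation_fin_num// Lfun2_mul_Lfun1.
rewrite -(fineK fE) -EFinB -EFin_expe fineB//= subrK.
by congr (fine 'E_P[_]%E); apply/funext => w.
Qed.

Lemma covariance_indic E F : measurable E -> measurable F ->
  P (E `&` F) = (P E * P F)%E -> covariance P \1_E \1_F = 0.
Proof.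
move=> mE mF PEF.
have E2 := Lfun2_indic mE; have F2 := Lfun2_indic mF.
rewrite covarianceE ?Lfun2_mul_Lfun1 ?Lfun2_1//.
rewrite (_ : \1_E * \1_F = \1_(E `&` F))%R; last by rewrite indicI.
rewrite !expectation_indic//; last exact: measurableI.
by rewrite PEF subee// fin_numM ?fin_num_measure.
Qed.

(** The mean and the variance of an averaging recursion driven by uncorrelated
    inputs: the input of rank n + 1 is uncorrelated with the average of the
    first n ones. *)
Lemma averaging_moments (gam : nat -> R) (Z Y : nat -> T -> R) :
  (forall n, (0 < n)%N -> Z n \in Lfun P 2%:E) ->
  (forall i j, (0 < i < j)%N -> covariance P (Z i) (Z j) = 0) ->
  Y 0%N = cst 0 ->
  (forall n, Y n.+1 = fun w => (1 - gam n.+1) * Y n w + gam n.+1 * Z n.+1 w) ->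
  forall n, [/\ Y n \in Lfun P 2%:E,
    fine 'E_P[Y n.+1] =
      (1 - gam n.+1) * fine 'E_P[Y n] + gam n.+1 * fine 'E_P[Z n.+1] &
    fine 'V_P[Y n.+1] =
      (1 - gam n.+1) ^+ 2 * fine 'V_P[Y n] +
      gam n.+1 ^+ 2 * fine 'V_P[Z n.+1]].
Proof.
move=> Z2 covZ Y0 YS.
have Y2 n : Y n \in Lfun P 2%:E.
  elim: n => [|n IH]; first by rewrite Y0 Lfun_cst.
  by rewrite YS Lfun2_lincomb ?Z2.
have covY n k : (n < k)%N -> covariance P (Y n) (Z k) = 0.
  elim: n => [|n IH] nk; first by rewrite Y0 covariance_cst_l.
  have k0 : (0 < k)%N := leq_ltn_trans (leq0n _) nk.
  by rewrite YS covariance_lincomb ?Y2 ?Z2 ?covZ// IH// ltnW.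
move=> n; split=> //.
  by rewrite YS mean_lincomb ?Y2 ?Z2.
by rewrite YS variance_lincomb ?Y2 ?Z2 ?covY.
Qed.

End moments.

(** * The inputs of the estimator at an end point *)

Section statistic.
Variable R : realType.
Implicit Types (x y : R).

(** At x = 0 only the Bernstein polynomial of rank 0 is nonzero, at x = 1 only
    that of rank m - 1. *)
Lemma Tstat_edge m x y : (0 < m)%N -> x = 0 \/ x = 1 ->
  Tstat m x y = m%:R * \1_(edge_cell x m%:R^-1) y.
Proof.
case: m => // m _ x01; rewrite /Tstat; congr (_ * _).
have m1 : (m.+1%:R : R) != 0 by rewrite pnatr_eq0.
case: x01 => ->.
  rewrite big_ord_recl big1 ?addr0; last first.
    move=> i _; rewrite /bernstein/= /bump/= add1n exprS.
    by rewrite mul0r mulr0 mul0r mulr0.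
  rewrite /bernstein/= bin0 expr0 subr0 expr1n !mulr1 indicE.
  congr (nat_of_bool _)%:R; rewrite mul0r div1r.
  rewrite /edge_cell mulr0 add0r.
  by apply/idP/idP; rewrite inE /= in_itv.
rewrite big_ord_recr big1; last first.
  move=> i _; rewrite /bernstein/= subrr [in X in _ * X]exprnP.
  by rewrite -exprnP expr0n subn_eq0 leqNgt ltn_ord !mulr0.
rewrite /bernstein/= add0r binn subnn expr1n expr0 !mulr1 indicE divff//.
congr (nat_of_bool _)%:R; rewrite /edge_cell mulr1 subrK.
have -> : m%:R / m.+1%:R = 1 - m.+1%:R^-1 :> R.
  by rewrite -natr1; field; rewrite natr1.
by apply/idP/idP; rewrite inE /= in_itv.
Qed.

Lemma Zstat_edge m x y : (0 < m)%N -> ~~ odd m -> x = 0 \/ x = 1 ->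
  Zstat m x y = 2 * m%:R * \1_(edge_cell x m%:R^-1) y
              + (- (m%:R / 2)) * \1_(edge_cell x (2 / m%:R)) y.
Proof.
move=> m0 me x01.
have mE : m = (m./2).*2 by rewrite even_halfK.
have h0 : (0 < m./2)%N by rewrite -double_gt0 -mE.
have hm : (m./2)%:R = m%:R / 2 :> R.
  by rewrite [in RHS]mE -muln2 natrM mulfK// pnatr_eq0.
by rewrite /Zstat !Tstat_edge// hm invf_div mulrA mulNr.
Qed.

Lemma edge_cellS x h k : x = 0 \/ x = 1 -> 0 <= h <= k ->
  edge_cell x h `<=` edge_cell x k.
Proof.
move=> x01 /andP[h0 hk] t; rewrite /edge_cell /= !in_itv/= => /andP[].
by case: x01 => ->; move=> ? ?; apply/andP; split; lra.
Qed.

Lemma measurable_edge_cell x h : measurable (edge_cell x h).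
Proof. exact: measurable_itv. Qed.

Lemma Delta2_edge (f : R -> R) x : x = 0 \/ x = 1 ->
  Delta2 f x = derive_within `[0, 1] (derive_within `[0, 1] f) x / 6.
Proof.
move=> x01.
have H (d2 d3 d4 : R) : 6^-1 * (1 - 6 * x * (1 - x)) * d2
    + 5 / 12 * x * (1 - x) * (1 - 2 * x) * d3
    + 8^-1 * x ^+ 2 * (1 - x) ^+ 2 * d4 = d2 / 6.
  by case: x01 => ->; field.
exact: H.
Qed.

End statistic.

Section independence.
Context d (T : measurableType d) (R : realType) (P : probability T R).
Variable X : nat -> {RV P >-> R}.

Lemma mutually_independent2 (I : set nat) i j (A B : set R) :
  mutually_independent I X -> I i -> I j -> i != j ->
  measurable A -> measurable B ->
  P (X i @^-1` A `&` X j @^-1` B) =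
    (P (X i @^-1` A) * P (X j @^-1` B))%E.
Proof.
move=> indep Ii Ij ij mA mB.
pose J := (i |` [fset j])%fset.
pose C k := if k == i then A else B.
have := indep J C.
rewrite /J big_fsetU1/= ?inE// big_seq_fset1 /C eqxx eq_sym (negbTE ij).
have -> : \bigcap_(k in [set` (i |` [fset j])%fset])
    (X k @^-1` (if k == i then A else B)) = X i @^-1` A `&` X j @^-1` B.
  apply/seteqP; split=> w /=.
    move=> h; split.
      by have := h i; rewrite /= !inE !eqxx; apply.
    have := h j; rewrite /= !inE eqxx orbT [j == i]eq_sym (negbTE ij).
    exact.
  move=> [wi wj] k /=; rewrite !inE => /orP[/eqP ->|/eqP ->].
    by rewrite eqxx.
  by rewrite eq_sym (negbTE ij).
apply.
- by move=> k /=; rewrite !inE => /orP[/eqP ->|/eqP ->].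
- by move=> k _; case: ifP.
Qed.

End independence.

Section input.
Context d (T : measurableType d) (R : realType) (P : probability T R).
Implicit Types (X : {RV P >-> R}) (x : R) (m : nat).

(** The probability that the observation falls in a cell next to x. *)
Definition edge_prob X x h : R := fine (P (X @^-1` edge_cell x h)).

Lemma Zstat_edge_indic X m x : (0 < m)%N -> ~~ odd m -> x = 0 \/ x = 1 ->
  (fun w => Zstat m x (X w)) = (fun w =>
    2 * m%:R * \1_(X @^-1` edge_cell x m%:R^-1) w
    + (- (m%:R / 2)) * \1_(X @^-1` edge_cell x (2 / m%:R)) w).
Proof.
by move=> m0 me x01; apply/funext => w; rewrite Zstat_edge.
Qed.

Lemma measurable_edge X x h : measurable (X @^-1` edge_cell x h).
Proof.
rewrite -[_ @^-1` _]setTI; apply: measurable_funP => //.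
exact: measurable_edge_cell.
Qed.

Lemma Zstat_Lfun2 X m x : (0 < m)%N -> ~~ odd m -> x = 0 \/ x = 1 ->
  (fun w => Zstat m x (X w)) \in Lfun P 2%:E.
Proof.
move=> m0 me x01; rewrite Zstat_edge_indic//.
by apply: Lfun2_lincomb; apply: Lfun2_indic; exact: measurable_edge.
Qed.

Lemma Zstat_mean X m x : (0 < m)%N -> ~~ odd m -> x = 0 \/ x = 1 ->
  fine 'E_P[fun w => Zstat m x (X w)] =
  2 * m%:R * edge_prob X x m%:R^-1 - m%:R / 2 * edge_prob X x (2 / m%:R).
Proof.
move=> m0 me x01; rewrite Zstat_edge_indic//.
rewrite mean_lincomb ?Lfun2_indic//; try exact: measurable_edge.
by rewrite !expectation_indic ?mulNr//; exact: measurable_edge.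
Qed.

(** The cells are nested, hence the product of their indicators is the indicator
    of the smaller one. *)
Lemma Zstat_variance X m x : (0 < m)%N -> ~~ odd m -> x = 0 \/ x = 1 ->
  fine 'V_P[fun w => Zstat m x (X w)] =
  2 * m%:R ^+ 2 * edge_prob X x m%:R^-1
  + m%:R ^+ 2 / 4 * edge_prob X x (2 / m%:R)
  - fine 'E_P[fun w => Zstat m x (X w)] ^+ 2.
Proof.
move=> m0 me x01.
have Z2 := Zstat_Lfun2 X m0 me x01.
rewrite varianceE//.
have fE : ('E_P[fun w => Zstat m x (X w)])%E \is a fin_num.
  by rewrite expectation_fin_num// Lfun2_1.
have fS : ('E_P[(fun w => Zstat m x (X w)) ^+ 2])%E \is a fin_num.
  by rewrite expectation_fin_num// Lfun2_mul_Lfun1.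
rewrite -(fineK fE) -EFin_expe fineB//=; congr (_ - _).
rewrite Zstat_edge_indic//.
set E := X @^-1` edge_cell x m%:R^-1.
set F := X @^-1` edge_cell x (2 / m%:R).
have sEF : E `<=` F.
  move=> w; apply: edge_cellS => //.
  by rewrite invr_ge0 ler0n/= ler_peMl ?invr_ge0// ler1n.
have -> : (fun w => 2 * m%:R * \1_E w + - (m%:R / 2) * \1_F w) ^+ 2 =
    (fun w => 2 * m%:R ^+ 2 * \1_E w + m%:R ^+ 2 / 4 * \1_F w) :> (T -> R).
  apply/funext => w.
  rewrite -[LHS]/((2 * m%:R * \1_E w + - (m%:R / 2) * \1_F w) ^+ 2).
  rewrite !indicE.
  case: (boolP (w \in E)) => wE.
    have -> : w \in F by move: wE; rewrite !inE => /sEF.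
    by rewrite !mulr1n; field.
  by case: (w \in F); rewrite ?mulr1n ?mulr0n; field.
rewrite mean_lincomb ?Lfun2_indic//; try exact: measurable_edge.
by rewrite !expectation_indic//; exact: measurable_edge.
Qed.

Lemma Zstat_uncorrelated (X : nat -> {RV P >-> R}) (I : set nat) i j m m' x :
  mutually_independent I X -> I i -> I j -> i != j ->
  (0 < m)%N -> ~~ odd m -> (0 < m')%N -> ~~ odd m' -> x = 0 \/ x = 1 ->
  covariance P (fun w => Zstat m x (X i w)) (fun w => Zstat m' x (X j w)) = 0.
Proof.
move=> indep Ii Ij ij m0 me m0' me' x01.
have L2 k h : (\1_(X k @^-1` edge_cell x h) : T -> R) \in Lfun P 2%:E.
  by apply: Lfun2_indic; exact: measurable_edge.
have Z2 := Zstat_Lfun2 (X j) m0' me' x01.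
have cov h h' : covariance P \1_(X i @^-1` edge_cell x h)
    \1_(X j @^-1` edge_cell x h') = 0.
  apply: covariance_indic; [exact: measurable_edge|exact: measurable_edge|].
  by apply: (mutually_independent2 indep) => //; exact: measurable_edge_cell.
rewrite Zstat_edge_indic//; apply: covariance_lincomb => //;
  by rewrite covarianceC Zstat_edge_indic//; apply: covariance_lincomb => //;
  rewrite covarianceC.
Qed.

Lemma edge_prob_density X f x h : has_density X f ->
  edge_prob X x h = \int[lebesgue_measure]_(t in edge_cell x h) f t.
Proof.
case=> _ _ /(_ _ (measurable_edge_cell x h)) fX.
by rewrite /edge_prob /Rintegral -fX.
Qed.

End input.

Section input_asymptotics.
Variable R : realType.
Implicit Types (p : R -> R) (M : nat -> R).

(** The remainder of a third-order expansion of p at 0+ is negligible along the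
    steps c / M_n. *)
Lemma expansion_remainder p (A B C c : R) M :
  (forall e, 0 < e ->
    exists2 dl, 0 < dl & forall h, 0 < h -> h < dl -> h <= 1 ->
    `|p h - (A * h + B * h ^+ 2 + C * h ^+ 3)| <= e * h ^+ 3) ->
  0 < c -> (forall n, (0 < n)%N -> 0 < M n) ->
  (M n)^-1 @[n --> \oo] --> 0 ->
  (p (c / M n) - (A * (c / M n) + B * (c / M n) ^+ 2 + C * (c / M n) ^+ 3))
    * M n ^+ 3 @[n --> \oo] --> 0.
Proof.
move=> hp c0 M0 Mc; apply/cvgrPdist_le => e e0.
have e1 : 0 < e / c ^+ 3 by rewrite divr_gt0// exprn_gt0.
have [dl dl0 hdl] := hp _ e1.
have dc : 0 < Num.min (dl / 2) 1 / c by rewrite divr_gt0// lt_min divr_gt0/=.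
move/cvgrPdist_le/(_ _ dc): Mc => Mc.
near=> n.
have n0 : (0 < n)%N by near: n; exact: near_ge1.
have Mn := M0 _ n0.
have : `|0 - (M n)^-1| <= Num.min (dl / 2) 1 / c by near: n.
rewrite sub0r normrN gtr0_norm ?invr_gt0// ler_pdivlMr// mulrC le_min.
set h := c / M n => /andP[h1 h2].
have h0 : 0 < h by rewrite divr_gt0.
have hd : h < dl by lra.
rewrite sub0r normrN normrM [X in _ * X]gtr0_norm ?exprn_gt0//.
have := hdl h h0 hd h2.
have -> : e / c ^+ 3 * h ^+ 3 = e / M n ^+ 3.
  by rewrite /h; field; rewrite !gt_eqF.
by rewrite ler_pdivlMr ?exprn_gt0.
Unshelve. all: by end_near. Qed.

(** The mean E n of the input and its second moment S n, in terms of the cell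
    probabilities p: the combination E n removes the coefficient B of h^2. *)
Lemma extrapolation_asymptotics p (A B C : R) M :
  (forall e, 0 < e ->
    exists2 dl, 0 < dl & forall h, 0 < h -> h < dl -> h <= 1 ->
    `|p h - (A * h + B * h ^+ 2 + C * h ^+ 3)| <= e * h ^+ 3) ->
  (forall n, (0 < n)%N -> 0 < M n) ->
  (M n)^-1 @[n --> \oo] --> 0 ->
  let E n := 2 * M n * p (M n)^-1 - M n / 2 * p (2 / M n) in
  let S n := 2 * M n ^+ 2 * p (M n)^-1 + M n ^+ 2 / 4 * p (2 / M n) in
  M n ^+ 2 * (E n - A) @[n --> \oo] --> - 2 * C /\
  (S n - E n ^+ 2) / M n @[n --> \oo] --> 5 / 2 * A.
Proof.
move=> hp M0 Mc E S.
have := expansion_remainder hp ltr01 M0 Mc.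
have := expansion_remainder hp (ltr0Sn R 1) M0 Mc.
set r2 := fun n => _ * _; set r1 := fun n => (p (1 / _) - _) * _ => r2c r1c.
have M1 : \forall n \near \oo, M n != 0.
  near=> n; rewrite gt_eqF// M0//; near: n; exact: near_ge1.
have Ec : M n ^+ 2 * (E n - A) @[n --> \oo] --> - 2 * C.
  have := seq_cvgD (seq_cvgD (@seq_cvgc _ (- 2 * C))
    (seq_cvgM (@seq_cvgc _ 2) r1c)) (seq_cvgM (@seq_cvgc _ (- 1 / 2)) r2c).
  rewrite !mulr0 !addr0; apply: cvg_eq_near; near=> n.
  have Mn : M n != 0 by near: n.
  by rewrite /E /r1 /r2 div1r; field.
split=> //.
have E0 : E n @[n --> \oo] --> A.
  have := seq_cvgD (seq_cvgM Ec (seq_cvgM Mc Mc)) (@seq_cvgc _ A).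
  rewrite !mulr0 add0r; apply: cvg_eq_near; near=> n.
  have Mn : M n != 0 by near: n.
  by field.
have Sc : S n / M n @[n --> \oo] --> 5 / 2 * A.
  have h1 := seq_cvgM (@seq_cvgc _ (3 * B)) Mc.
  have h2 := seq_cvgM (seq_cvgM Mc Mc) (seq_cvgD (@seq_cvgc _ (4 * C))
    (seq_cvgD (seq_cvgM (@seq_cvgc _ 2) r1c)
      (seq_cvgM (@seq_cvgc _ (1 / 4)) r2c))).
  have := seq_cvgD (seq_cvgD (@seq_cvgc _ (5 / 2 * A)) h1) h2.
  rewrite !mulr0 mul0r !addr0; apply: cvg_eq_near; near=> n.
  have Mn : M n != 0 by near: n.
  by rewrite /S /r1 /r2 div1r; field.
have := seq_cvgB Sc (seq_cvgM (seq_cvgM E0 E0) Mc).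
rewrite mulr0 subr0; apply: cvg_eq_near; near=> n.
by rewrite [RHS]mulrBl expr2.
Unshelve. all: by end_near. Qed.

End input_asymptotics.

(** * Asymptotics of the bias and of the variance *)

Section limits.
Variable R : realType.
Variables (gam mu mR : nat -> R) (alpha a xi : R).
Hypothesis alpha0 : 0 < alpha.
Hypothesis a0 : 0 < a.
Hypothesis gamGS : GS (- alpha) gam.
Hypothesis muGS : GS a mu.
Hypothesis mR0 : forall n, (0 < n)%N -> 0 < mR n.
Hypothesis mR_mu : mR n / mu n @[n --> \oo] --> (1 : R).
Hypothesis ngam : (n%:R * gam n)^-1 @[n --> \oo] --> xi.

Let gam0 n : (0 < n)%N -> 0 < gam n.
Proof. exact: GS_gt0 gamGS. Qed.
Let mu0 n : (0 < n)%N -> 0 < mu n.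
Proof. exact: GS_gt0 muGS. Qed.

Let gamc : gam n @[n --> \oo] --> (0 : R).
Proof. by apply: GS_cvg0 gamGS; rewrite oppr_lt0. Qed.

Let mu_mR : mu n / mR n @[n --> \oo] --> (1 : R).
Proof.
have := seq_cvgV (oner_neq0 R) mR_mu; rewrite invr1.
by apply: cvg_eq_near; near=> n; rewrite invf_div.
Unshelve. all: by end_near. Qed.

Lemma order_cvg0 : (mR n)^-1 @[n --> \oo] --> (0 : R).
Proof.
have imu : (mu n)^-1 @[n --> \oo] --> (0 : R).
  by apply: GS_cvg0 (GS_inv muGS); rewrite oppr_lt0.
have := seq_cvgM mu_mR imu; rewrite mulr0; apply: cvg_eq_near; near=> n.
have n0 : (0 < n)%N by near: n; exact: near_ge1.
by rewrite mulrAC divff ?mul1r// gt_eqF// mu0.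
Unshelve. all: by end_near. Qed.

Section bias.
Variables (b e : nat -> R) (beta : R).
Hypothesis bS : forall n, (0 < n)%N -> b n = (1 - gam n) * b n.-1 + gam n * e n.
Hypothesis ec : mR n ^+ 2 * e n @[n --> \oo] --> beta.

Let step1 : (1 - (1 - gam n)) / gam n @[n --> \oo] --> (1 : R).
Proof.
apply: (@cvg_eq_near _ (fun=> 1)); last exact: seq_cvgc.
near=> n.
have n0 : (0 < n)%N by near: n; exact: near_ge1.
by rewrite subKr divff// gt_eqF// gam0.
Unshelve. all: by end_near. Qed.

Let muec : mu n ^+ 2 * e n @[n --> \oo] --> beta.
Proof.
have := seq_cvgM (seq_cvgM mu_mR mu_mR) ec; rewrite !mul1r.
apply: cvg_eq_near; near=> n.
have n0 : (0 < n)%N by near: n; exact: near_ge1.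
by field; rewrite gt_eqF// mR0.
Unshelve. all: by end_near. Qed.

(** [GS_recursion] on the scale mu_n^2. *)
Lemma bias_cvg : 0 < 1 - 2 * a * xi ->
  mR n ^+ 2 * b n @[n --> \oo] --> beta / (1 - 2 * a * xi).
Proof.
move=> k0.
have k0' : 0 < 1 - (a + a) * xi by lra.
have := GS_recursion (GS_mul muGS muGS) gam0 gamc ngam k0' bS step1 muec.
move/(seq_cvgM (seq_cvgM mR_mu mR_mu)); rewrite !mul1r.
rewrite (_ : a + a = 2 * a); last by ring.
apply: cvg_eq_near; near=> n.
have n0 : (0 < n)%N by near: n; exact: near_ge1.
by field; rewrite gt_eqF// mu0.
Unshelve. all: by end_near. Qed.

(** [GS_recursion] on the scale (gam_n mu_n)^(-1/2), on which the forcing term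
    is of order (gam_n mu_n)^(-1/2) mu_n^-2, of class GS((alpha - 5 a) / 2). *)
Lemma bias_negligible : alpha < 5 * a -> 0 < 2 - (alpha - a) * xi ->
  b n / Num.sqrt (gam n * mR n) @[n --> \oo] --> (0 : R).
Proof.
move=> aa k0.
have gsV := GS_inv (GS_sqrt (GS_mul gamGS muGS)).
have k0' : 0 < 1 - (- ((- alpha + a) / 2)) * xi by lra.
have small : (Num.sqrt (gam n * mu n))^-1 * e n @[n --> \oo] --> (0 : R).
  have gs := GS_mul gsV (GS_inv (GS_mul muGS muGS)).
  have neg : - ((- alpha + a) / 2) + - (a + a) < 0 by lra.
  have := seq_cvgM (GS_cvg0 neg gs) muec; rewrite mul0r.
  apply: cvg_eq_near; near=> n.
  have n0 : (0 < n)%N by near: n; exact: near_ge1.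
  by field; rewrite !gt_eqF ?sqrtr_gt0 ?mulr_gt0 ?mu0 ?gam0.
have := GS_recursion gsV gam0 gamc ngam k0' bS step1 small.
have r1 : Num.sqrt (mu n / mR n) @[n --> \oo] --> (1 : R).
  rewrite -[X in _ --> X]sqrtr1.
  exact: (continuous_cvg _ (@sqrt_continuous R 1) mu_mR).
move/(seq_cvgM r1); rewrite mul0r mulr0; apply: cvg_eq_near; near=> n.
have n0 : (0 < n)%N by near: n; exact: near_ge1.
have gn := gam0 n0; have un := mu0 n0; have mn := mR0 n0.
have -> : Num.sqrt (mu n / mR n) =
    Num.sqrt (gam n * mu n) / Num.sqrt (gam n * mR n).
  rewrite -sqrtrV ?mulr_ge0 ?ltW// -sqrtrM ?mulr_ge0 ?ltW//.
  by congr Num.sqrt; field; rewrite !gt_eqF.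
by field; rewrite !gt_eqF ?sqrtr_gt0 ?mulr_gt0.
Unshelve. all: by end_near. Qed.

End bias.

Section variance.
Variables (v V : nat -> R) (kappa : R).
Hypothesis vS : forall n, (0 < n)%N ->
  v n = (1 - gam n) ^+ 2 * v n.-1 + gam n ^+ 2 * V n.
Hypothesis Vc : V n / mR n @[n --> \oo] --> kappa.

Let vS' n : (0 < n)%N ->
  v n = (1 - gam n) ^+ 2 * v n.-1 + gam n * (gam n * V n).
Proof. by move=> n0; rewrite vS// mulrA. Qed.

Let step2 : (1 - (1 - gam n) ^+ 2) / gam n @[n --> \oo] --> (2 : R).
Proof.
have := seq_cvgB (@seq_cvgc _ 2) gamc; rewrite subr0.
apply: cvg_eq_near; near=> n.
have n0 : (0 < n)%N by near: n; exact: near_ge1.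
by field; rewrite gt_eqF// gam0.
Unshelve. all: by end_near. Qed.

Let Vmuc : V n / mu n @[n --> \oo] --> kappa.
Proof.
have := seq_cvgM mR_mu Vc; rewrite !mul1r.
apply: cvg_eq_near; near=> n.
have n0 : (0 < n)%N by near: n; exact: near_ge1.
by field; rewrite !gt_eqF// ?mR0 ?mu0.
Unshelve. all: by end_near. Qed.

(** [GS_recursion] on the scale (gam_n mu_n)^-1. *)
Lemma variance_cvg : 0 < 2 - (alpha - a) * xi ->
  v n / (gam n * mR n) @[n --> \oo] --> kappa / (2 - (alpha - a) * xi).
Proof.
move=> k0.
have k0' : 0 < 2 - (- (- alpha + a)) * xi by lra.
have sc : (gam n * mu n)^-1 * (gam n * V n) @[n --> \oo] --> kappa.
  have := Vmuc; apply: cvg_eq_near; near=> n.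
  have n0 : (0 < n)%N by near: n; exact: near_ge1.
  by field; rewrite !gt_eqF// ?mu0 ?gam0.
have gsV := GS_inv (GS_mul gamGS muGS).
have := GS_recursion gsV gam0 gamc ngam k0' vS' step2 sc.
move/(seq_cvgM mu_mR); rewrite mul1r opprD opprK.
apply: cvg_eq_near; near=> n.
have n0 : (0 < n)%N by near: n; exact: near_ge1.
by field; rewrite !gt_eqF// ?mu0 ?gam0 ?mR0.
Unshelve. all: by end_near. Qed.

(** [GS_recursion] on the scale mu_n^4, on which the forcing term is of order
    gam_n mu_n^5, of class GS(5 a - alpha). *)
Lemma variance_negligible : 5 * a < alpha -> 0 < 1 - 2 * a * xi ->
  mR n ^+ 4 * v n @[n --> \oo] --> (0 : R).
Proof.
move=> aa k0.
have gs4 := GS_mul (GS_mul muGS muGS) (GS_mul muGS muGS).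
have k0' : 0 < 2 - (a + a + (a + a)) * xi by lra.
have sc : mu n * mu n * (mu n * mu n) * (gam n * V n) @[n --> \oo] --> (0 : R).
  have neg : a + a + (a + a) + (- alpha + a) < 0 by lra.
  have := seq_cvgM (GS_cvg0 neg (GS_mul gs4 (GS_mul gamGS muGS))) Vmuc.
  rewrite mul0r; apply: cvg_eq_near; near=> n.
  have n0 : (0 < n)%N by near: n; exact: near_ge1.
  by field; rewrite !gt_eqF// ?mu0.
have := GS_recursion gs4 gam0 gamc ngam k0' vS' step2 sc.
move/(seq_cvgM (seq_cvgM (seq_cvgM mR_mu mR_mu) (seq_cvgM mR_mu mR_mu))).
rewrite mul0r mulr0; apply: cvg_eq_near; near=> n.
have n0 : (0 < n)%N by near: n; exact: near_ge1.
by field; rewrite !gt_eqF// ?mu0.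
Unshelve. all: by end_near. Qed.

End variance.
End limits.

(** The limit L is positive: if a < alpha, it exceeds the positive number
    min(2 a, (alpha - a) / 2); otherwise alpha <= a < 1, and n gam_n, of class
    GS(1 - alpha), tends to infinity. Hence (n gam_n)^-1 tends to 1 / L, which
    is 0 if L is infinite. *)
Lemma stepsize_cvg (R : realType) (gam : nat -> R) (alpha a : R) (L : \bar R) :
  a < 1 -> GS (- alpha) gam ->
  (n%:R * gam n)%:E @[n --> \oo] --> L ->
  ((Num.min (2 * a) ((alpha - a) / 2))%:E < L)%E -> 0 < a ->
  exists2 xi : R, (n%:R * gam n)^-1 @[n --> \oo] --> xi &
    forall t : R, (t%:E < L)%E -> 0 < 1 - t * xi.
Proof.
move=> a1 gamGS ngL Lr a0.
have gs := GS_mul (GS_id R) gamGS.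
have pos : \forall n \near \oo, 0 < n%:R * gam n.
  near=> n; apply: (GS_gt0 gs); near: n; exact: near_ge1.
case: L ngL Lr => [l| |] // ngL Lr; last first.
  exists 0; last by move=> s _; rewrite mulr0 subr0.
  by apply/(gtr0_cvgV0 pos); apply/cvgeryP.
have Lr' : Num.min (2 * a) ((alpha - a) / 2) < l by rewrite -lte_fin.
have {}ngL : n%:R * gam n @[n --> \oo] --> l by move/fine_cvgP: ngL => [].
have l_ge0 : 0 <= l.
  rewrite -(cvg_lim _ ngL)//; apply: limr_ge; first exact: cvgP ngL.
  by apply: filterS pos => n /ltW.
have l0 : 0 < l.
  have [al|al] := ltP a alpha.
    apply: le_lt_trans Lr'; rewrite le_min; apply/andP; split; lra.
  rewrite lt_neqAle l_ge0 andbT; apply/eqP => l0.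
  have : (n%:R * gam n)^-1 @[n --> \oo] --> (0 : R).
    by apply: GS_cvg0 (GS_inv gs); lra.
  move=> /(seq_cvgM ngL); rewrite mulr0.
  move=> /(cvg_eq_near (g := fun=> 1)) h.
  have /h {h} : \forall n \near \oo, n%:R * gam n * (n%:R * gam n)^-1 = 1.
    by apply: filterS pos => n n0; rewrite divff// gt_eqF.
  move=> /(cvg_lim (@Rhausdorff R)); rewrite lim_cst// => /eqP.
  by rewrite oner_eq0.
exists l^-1; first by apply: seq_cvgV ngL; rewrite gt_eqF.
by move=> s; rewrite lte_fin => sl; rewrite subr_gt0 ltr_pdivrMr// mul1r.
Unshelve. all: by end_near. Qed.

(** * Limits of quotients as Landau estimates *)

Section landau.
Variable R : realType.
Implicit Types (u v g h : nat -> R).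

Lemma littleo_cvg u h (l : R) :
  (forall n, (0 < n)%N -> 0 < h n) -> u n / h n @[n --> \oo] --> l ->
  u = (fun n => l * h n) +o_\oo h.
Proof.
move=> h0 /cvgrPdist_le uh; apply/eqaddoP => e e0.
have {}uh := uh e e0; near=> n.
have n0 : (0 < n)%N by near: n; exact: near_ge1.
have hn := h0 _ n0.
have : `|l - u n / h n| <= e by near: n.
rewrite /= -[(u - _) n]/(u n - l * h n) (gtr0_norm hn) distrC.
have -> : u n - l * h n = (u n / h n - l) * h n by field; rewrite gt_eqF.
by rewrite normrM (gtr0_norm hn) => ?; rewrite ler_wpM2r// ltW.
Unshelve. all: by end_near. Qed.

Lemma littleo_cvg0 u h :
  (forall n, (0 < n)%N -> 0 < h n) -> u n / h n @[n --> \oo] --> (0 : R) ->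
  u =o_\oo h.
Proof.
move=> h0 /(littleo_cvg h0)/eqaddoP uh; apply/eqoP => e e0.
have := uh e e0; apply: filterS => n.
by rewrite -[(u - _) n]/(u n - 0 * h n) mul0r subr0.
Qed.

Lemma littleoD u v g h (k l : R) :
  (forall n, (0 < n)%N -> 0 < g n) -> (forall n, (0 < n)%N -> 0 < h n) ->
  u n / g n @[n --> \oo] --> k -> v n / h n @[n --> \oo] --> l ->
  (fun n => u n + v n) =
    (fun n => k * g n + l * h n) +o_\oo (fun n => g n + h n).
Proof.
move=> g0 h0 /(littleo_cvg g0)/eqaddoP ug /(littleo_cvg h0)/eqaddoP vh.
apply/eqaddoP => e e0.
have {}ug := ug e e0; have {}vh := vh e e0; near=> n.
have n0 : (0 < n)%N by near: n; exact: near_ge1.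
have : `|(u - (fun n => k * g n)) n| <= e * `|g n| by near: n.
have : `|(v - (fun n => l * h n)) n| <= e * `|h n| by near: n.
rewrite -[(u - _) n]/(u n - k * g n) -[(v - _) n]/(v n - l * h n).
rewrite -[X in _ -> _ -> `|X| <= _]/(u n + v n - (k * g n + l * h n)).
rewrite (gtr0_norm (g0 _ n0)) (gtr0_norm (h0 _ n0)).
have gh0 : 0 < g n + h n by rewrite addr_gt0 ?g0 ?h0.
rewrite /= (gtr0_norm gh0) mulrDr opprD addrACA => hv hu.
by rewrite (le_trans (ler_normD _ _))// lerD.
Unshelve. all: by end_near. Qed.

End landau.

(** * The recursive estimator at an end point *)

(* mu is only there to say that (m_n), a sequence of integers, behaves as a
   member of GS(a): GS(a) itself contains no sequence of integers if 0 < a < 1,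
   since the increments of such a sequence would tend to 0.  If (m_n) is itself
   taken to be in GS(a), use mu = m. *)
Theorem proposition2 (R : realType) (d : measure_display)
  (T : measurableType d) (P : probability T R)
  (X : nat -> {RV P >-> R}) (f : R -> R)
  (gam : nat -> R) (m : nat -> nat) (mu : nat -> R)
  (alpha a xi : R) (L : \bar R)
  (* X_1, X_2, ... i.i.d. with density f supported on [0, 1] *)
  (Xindep : mutually_independent [set n | (1 <= n)%N] X)
  (Xdens : forall n, (1 <= n)%N -> has_density (X n) f)
  (fsupp : forall t, t \notin `[0, 1] -> f t = 0)
  (fC4 : Cn_within `[0, 1] 4 f)
  (alpha_range : 1 / 2 < alpha <= 1)
  (gamGS : GS (- alpha) gam)
  (a_range : 0 < a < 1)
  (m_gt0 : forall n, (1 <= n)%N -> (0 < m n)%N)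
  (m_even : forall n, (1 <= n)%N -> ~~ odd (m n))
  (muGS : GS a mu)
  (m_mu : (m n)%:R / mu n @[n --> \oo] --> (1 : R))
  (ngamL : (n%:R * gam n)%:E @[n --> \oo] --> L)
  (L_range : ((Num.min (2 * a) ((alpha - a) / 2))%:E < L)%E)
  (xiE : xi = lim ((n%:R * gam n)^-1 @[n --> \oo]))
  (x : R) (x01 : x = 0 \/ x = 1) :
  let fn := rec_estimator X gam m x in
  let bias n := Bias P (fn n) (f x) in
  let var n := Var P (fn n) in
  let mse n := MSE P (fn n) (f x) in
  let mR n : R := (m n)%:R in
  let B' := bias = (fun n => - (mR n) ^- 2 * (2 / (1 - 2 * a * xi)) * Delta2 f x)
                   +o_\oo (fun n => (mR n) ^- 2) in
  let V' := var = (fun n => 5 / 2 * (gam n * mR n)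
                              * (1 / (2 - (alpha - a) * xi)) * f x)
                  +o_\oo (fun n => gam n * mR n) in
  [/\ (* 1 *)
      (0 < a <= alpha / 5 -> B') /\
      (alpha / 5 < a < 1 ->
        bias =o_\oo (fun n => Num.sqrt (gam n * mR n))),
      (* 2 *)
      (alpha / 5 <= a < 1 -> V') /\
      (0 < a < alpha / 5 -> var =o_\oo (fun n => (mR n) ^- 4)),
      (* 3 *)
      ((Num.max (2 * a) ((alpha - a) / 2))%:E < L)%E ->
        [/\ ((2 * a)%:E < L)%E, (((alpha - a) / 2)%:E < L)%E,
            0 < 1 - 2 * a * xi, 0 < 2 - (alpha - a) * xi & B' /\ V'] &
      (* 4 *)
      [/\ 0 < a < alpha / 5 ->
            mse = (fun n => (Delta2 f x) ^+ 2 * (mR n) ^- 4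
                              * (4 / (1 - 2 * a * xi) ^+ 2))
                  +o_\oo (fun n => (mR n) ^- 4),
          a = alpha / 5 ->
            mse = (fun n => (Delta2 f x) ^+ 2 * (mR n) ^- 4
                              * (4 / (1 - 2 * a * xi) ^+ 2)
                            + 5 / 2 * f x * (gam n * mR n)
                              * (1 / (2 - (alpha - a) * xi)))
                  +o_\oo (fun n => (mR n) ^- 4 + gam n * mR n) &
          alpha / 5 < a < 1 ->
            mse = (fun n => 5 / 2 * f x * (gam n * mR n)
                              * (1 / (2 - (alpha - a) * xi)))
                  +o_\oo (fun n => gam n * mR n)]].
Proof.
move=> fn bias var mse mR B' V'.
have alpha0 : 0 < alpha by lra.
have a0 : 0 < a by lra.
have a1 : a < 1 by lra.
have mR0 n : (0 < n)%N -> 0 < mR n by move=> n0; rewrite ltr0n m_gt0.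
have gam0 n : (0 < n)%N -> 0 < gam n by exact: GS_gt0 gamGS.
have [xi' ngam Lxi] := stepsize_cvg a1 gamGS ngamL L_range a0.
have {xi' ngam Lxi xiE} [ngam Lxi] : (n%:R * gam n)^-1 @[n --> \oo] --> xi /\
    (forall t : R, (t%:E < L)%E -> 0 < 1 - t * xi).
  have -> : xi = xi' by rewrite xiE; exact: cvg_lim ngam.
  by split.
have kB : ((2 * a)%:E < L)%E -> 0 < 1 - 2 * a * xi by exact: Lxi.
have kV : (((alpha - a) / 2)%:E < L)%E -> 0 < 2 - (alpha - a) * xi.
  by move=> /Lxi; lra.
have iM := order_cvg0 a0 muGS m_mu.
pose Z n w := Zstat (m n) x (X n w).
have Z2 n : (0 < n)%N -> Z n \in Lfun P 2%:E.
  by move=> n0; apply: Zstat_Lfun2; [exact: m_gt0|exact: m_even|].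
have covZ i j : (0 < i < j)%N -> covariance P (Z i) (Z j) = 0.
  move=> /andP[i0 ij]; have j0 := ltn_trans i0 ij.
  apply: (Zstat_uncorrelated Xindep) => //=; rewrite ?m_gt0 ?m_even//.
  by rewrite ltn_eqF.
(* fn satisfies the averaging recursion by definition *)
have momts := averaging_moments Z2 covZ (Y := fn) erefl (fun=> erefl).
have fn2 n : fn n \in Lfun P 2%:E by have [] := momts n.
pose p h := \int[lebesgue_measure]_(t in edge_cell x h) f t : R.
have pE n h : (0 < n)%N -> edge_prob (X n) x h = p h.
  by move=> n0; exact: edge_prob_density (Xdens n n0).
have [dfx _] := fC4.
have hp := Rintegral_edge_cell (fun t tI => dfx 0%N t isT tI) _ x01.
have xI : `[0, 1]%classic x.
  by rewrite /= in_itv/=; case: x01 => ->; rewrite ?lexx ?ler01.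
have {}hp := fun e => hp e (dfx 1%N x isT xI).
have [ec Vc] := extrapolation_asymptotics hp mR0 iM.
pose e n := fine 'E_P[Z n] - f x.
have {}ec : mR n ^+ 2 * e n @[n --> \oo] --> - 2 * Delta2 f x.
  rewrite (Delta2_edge f x01).
  move: ec; apply: cvg_eq_near; near=> n.
  have n0 : (0 < n)%N by near: n; exact: near_ge1.
  by rewrite /e Zstat_mean ?m_gt0 ?m_even// !pE.
have {}Vc : fine 'V_P[Z n] / mR n @[n --> \oo] --> 5 / 2 * f x.
  move: Vc; apply: cvg_eq_near; near=> n.
  have n0 : (0 < n)%N by near: n; exact: near_ge1.
  by rewrite Zstat_variance ?m_gt0 ?m_even// Zstat_mean ?m_gt0 ?m_even// !pE.
have biasS n : (0 < n)%N -> bias n = (1 - gam n) * bias n.-1 + gam n * e n.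
  by case: n => // n _; have [_ h _] := momts n; rewrite /bias /Bias h /e; ring.
have varS n : (0 < n)%N ->
    var n = (1 - gam n) ^+ 2 * var n.-1 + gam n ^+ 2 * fine 'V_P[Z n].
  by case: n => // n _; have [_ _ h] := momts n; rewrite /var /Var h.
have mseE n : mse n = var n + bias n ^+ 2 by exact: MSE_decomposition.
have bias_lim := bias_cvg alpha0 gamGS muGS mR0 m_mu ngam biasS ec.
have bias_o := bias_negligible alpha0 gamGS muGS mR0 m_mu ngam biasS ec.
have var_lim := variance_cvg alpha0 gamGS muGS mR0 m_mu ngam varS Vc.
have var_o := variance_negligible alpha0 gamGS muGS mR0 m_mu ngam varS Vc.
(* the minimum of 2 a and (alpha - a) / 2 is the first one iff a <= alpha / 5 *)
have minB : a <= alpha / 5 -> ((2 * a)%:E < L)%E.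
  move=> h; apply: le_lt_trans L_range; rewrite lee_fin le_min lexx/=; lra.
have minV : alpha / 5 <= a -> (((alpha - a) / 2)%:E < L)%E.
  move=> h; apply: le_lt_trans L_range; rewrite lee_fin le_min lexx andbT; lra.
have gm0 n : (0 < n)%N -> 0 < gam n * mR n.
  by move=> n0; rewrite mulr_gt0 ?gam0 ?mR0.
have im0 k n : (0 < n)%N -> 0 < mR n ^- k.
  by move=> n0; rewrite invr_gt0 exprn_gt0 ?mR0.
have sgm0 n : (0 < n)%N -> 0 < Num.sqrt (gam n * mR n).
  by move=> n0; rewrite sqrtr_gt0 gm0.
have HB : ((2 * a)%:E < L)%E -> B'.
  move=> /kB k0; rewrite /B'.
  have -> : (fun n => - mR n ^- 2 * (2 / (1 - 2 * a * xi)) * Delta2 f x) =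
      (fun n => (- 2 * Delta2 f x / (1 - 2 * a * xi)) * mR n ^- 2).
    by apply/funext => n; ring.
  apply: littleo_cvg; first exact: im0.
  move: (bias_lim k0); apply: cvg_eq_near; near=> n.
  by rewrite invrK mulrC.
have HV : (((alpha - a) / 2)%:E < L)%E -> V'.
  move=> /kV k0; rewrite /V'.
  have -> : (fun n => 5 / 2 * (gam n * mR n) *
      (1 / (2 - (alpha - a) * xi)) * f x) =
      (fun n => (5 / 2 * f x / (2 - (alpha - a) * xi)) * (gam n * mR n)).
    by apply/funext => n; ring.
  by apply: littleo_cvg; [exact: gm0|exact: var_lim].
(* the square of the bias, in units of m_n^-4 and of gamma_n m_n *)
have bias2 : ((2 * a)%:E < L)%E -> bias n ^+ 2 / mR n ^- 4 @[n --> \oo] -->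
    Delta2 f x ^+ 2 * (4 / (1 - 2 * a * xi) ^+ 2).
  move=> /kB k0; have := seq_cvgM (bias_lim k0) (bias_lim k0).
  have -> : - 2 * Delta2 f x / (1 - 2 * a * xi) *
      (- 2 * Delta2 f x / (1 - 2 * a * xi)) =
      Delta2 f x ^+ 2 * (4 / (1 - 2 * a * xi) ^+ 2).
    by field; rewrite gt_eqF.
  apply: cvg_eq_near; near=> n.
  by rewrite invrK; ring.
have bias2_o : alpha / 5 < a ->
    bias n ^+ 2 / (gam n * mR n) @[n --> \oo] --> (0 : R).
  move=> h; have h5 : alpha < 5 * a by lra.
  have k0 := kV (minV (ltW h)).
  have := seq_cvgM (bias_o h5 k0) (bias_o h5 k0); rewrite mul0r.
  apply: cvg_eq_near; near=> n.
  have n0 : (0 < n)%N by near: n; exact: near_ge1.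
  by rewrite mulrACA -invfM -!expr2 sqr_sqrtr// ltW// gm0.
have mse_fun : mse = (fun n => var n + bias n ^+ 2) by exact/funext.
split.
- split=> [/andP[_ /minB /HB]//|/andP[h _]].
  apply: littleo_cvg0; first exact: sgm0.
  by apply: bias_o; [lra|exact: kV (minV (ltW h))].
- split=> [/andP[/minV /HV]//|/andP[_ h]].
  apply: littleo_cvg0; first exact: im0.
  have h5 : 5 * a < alpha by lra.
  have := var_o h5 (kB (minB (ltW h))); apply: cvg_eq_near; near=> n.
  by rewrite invrK mulrC.
- rewrite EFin_max gt_max => /andP[h2a hv].
  by split=> //; [exact: kB|exact: kV|split; [exact: HB|exact: HV]].
- split=> [/andP[_ h]|h|/andP[h _]]; rewrite mse_fun.
  + have h5 : 5 * a < alpha by lra.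
    have k2 := minB (ltW h).
    have := bias2 k2; set K := _ * _ => bK.
    have -> : (fun n => Delta2 f x ^+ 2 * mR n ^- 4 *
        (4 / (1 - 2 * a * xi) ^+ 2)) = (fun n => K * mR n ^- 4).
      by apply/funext => n; rewrite /K; ring.
    apply: littleo_cvg; first exact: im0.
    have := seq_cvgD (var_o h5 (kB k2)) bK; rewrite add0r.
    apply: cvg_eq_near; near=> n.
    by rewrite [RHS]mulrDl invrK [mR n ^+ 4 * _]mulrC.
  + have k2 : ((2 * a)%:E < L)%E by apply: minB; rewrite h.
    have kv : (((alpha - a) / 2)%:E < L)%E by apply: minV; rewrite h.
    have := littleoD (im0 4%N) gm0 (bias2 k2) (var_lim (kV kv)).
    have -> : (fun n => bias n ^+ 2 + var n) = (fun n => var n + bias n ^+ 2).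
      by apply/funext => n; rewrite addrC.
    set F := fun n => _ + _ * (gam n * _).
    suff -> : F = (fun n => Delta2 f x ^+ 2 * mR n ^- 4
          * (4 / (1 - 2 * a * xi) ^+ 2)
        + 5 / 2 * f x * (gam n * mR n) * (1 / (2 - (alpha - a) * xi))) by [].
    by apply/funext => n; rewrite /F; ring.
  + have kv := minV (ltW h).
    have -> : (fun n => 5 / 2 * f x * (gam n * mR n) *
        (1 / (2 - (alpha - a) * xi))) =
      (fun n => (5 / 2 * f x / (2 - (alpha - a) * xi)) * (gam n * mR n)).
      by apply/funext => n; ring.
    apply: littleo_cvg; first exact: gm0.
    have := seq_cvgD (var_lim (kV kv)) (bias2_o h); rewrite addr0.
    by apply: cvg_eq_near; near=> n; rewrite [RHS]mulrDl.
Unshelve. all: by end_near. Qed.
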